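(* Let $Y$ be an affine variety over a field $K$ of characteristic $0$, let $\mathbf{q}$ be a point in $Y$ and let $\sigma$ be an automorphism of $Y$. If $X$ is a subvariety of $Y$, then the set $$\{ m\in \mathbb{Z} \mid \sigma^{m}(\mathbf{q})\in X\}$$ is a union of a finite number of complete doubly-infinite arithmetic progressions and a finite set.
   Context: For a field $K$, $\mathbb{A}_K^N$ denotes the set $K^N$. An affine variety $Y$ over $K$ is the zero set in some $\mathbb{A}_K^N$ of a collection of polynomials over $K$, and a subvariety $X$ of $Y$ is a Zariski closed subset of $Y$, i.e. the zero set in $Y$ of finitely many polynomials. An automorphism of $Y$ is a bijective map $\sigma:Y\to Y$ such that both $\sigma$ and $\sigma^{-1}$ are morphisms, i.e. are given by restrictions of polynomial maps with coefficients in $K$. For $m\in\mathbb{Z}$, $\sigma^m$ is the $m$-th iterate (with $\sigma^{m}=(\sigma^{-1})^{-m}$ for $m<0$). A complete doubly-infinite arithmetic progression is a set of the form $\{a+bm \mid m\in\mathbb{Z}\}$ with $a,b\in\mathbb{Z}$, $b\ge 1$. The number of progressions may be zero and the finite set may be empty. *)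

(* Defs.v *)
From HB Require Import structures.
From mathcomp Require Import all_boot all_order all_algebra.
From mathcomp Require Import boolp classical_sets functions cardinality.
From mathcomp Require Import mpoly.

Set Implicit Arguments.
Unset Strict Implicit.
Unset Printing Implicit Defensive.

Import GRing.Theory Num.Theory.

Local Open Scope classical_set_scope.
Local Open Scope ring_scope.

(* Affine N-space over K is {ffun 'I_N -> K}. A set [Y] of points is also used
   as a type, through the coercion [set_type]; [\val] sends an element of that
   type to the underlying point. *)

Definition zero_locus (K : fieldType) (N : nat) (S : set {mpoly K[N]}) :
    set {ffun 'I_N -> K} :=
  [set x | forall p, S p -> p.@[x] = 0].

Definition affine_variety (K : fieldType) (N : nat) (Y : set {ffun 'I_N -> K}) : Prop :=
  exists S : set {mpoly K[N]}, Y = zero_locus S.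

Definition subvariety (K : fieldType) (N : nat) (Y X : set {ffun 'I_N -> K}) : Prop :=
  exists s : seq {mpoly K[N]}, X = Y `&` zero_locus [set` s].

Definition is_morphism (K : fieldType) (N M : nat)
    (Y : set {ffun 'I_N -> K}) (Z : set {ffun 'I_M -> K}) (f : Y -> Z) : Prop :=
  exists p : 'I_M -> {mpoly K[N]},
    forall (y : Y) (i : 'I_M), (\val (f y) : {ffun 'I_M -> K}) i = (p i).@[\val y].

Record automorphism (K : fieldType) (N : nat) (Y : set {ffun 'I_N -> K}) := Automorphism {
  aut_fun :> Y -> Y;
  aut_inv : Y -> Y;
  aut_funK : cancel aut_fun aut_inv;
  aut_invK : cancel aut_inv aut_fun;
  aut_fun_morphism : is_morphism aut_fun;
  aut_inv_morphism : is_morphism aut_inv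
}.

(* [Negz n] is the integer [- n.+1]. *)
Definition aut_iter (K : fieldType) (N : nat) (Y : set {ffun 'I_N -> K})
    (sigma : automorphism Y) (m : int) : Y -> Y :=
  match m with
  | Posz n => iter n sigma
  | Negz n => iter n.+1 (aut_inv sigma)
  end.

Definition complete_progression (a b : int) : set int :=
  [set n | exists m : int, n = a + b * m].

(* Main.v *)
Require Import Defs.
From HB Require Import structures.
From mathcomp Require Import all_boot all_order all_algebra.
From mathcomp Require Import boolp classical_sets functions cardinality.
From mathcomp Require Import mpoly.
From mathcomp Require Import zify ring.

Set Implicit Arguments.
Unset Strict Implicit.
Unset Printing Implicit Defensive.

Import GRing.Theory Num.Theory.

Local Open Scope classical_set_scope.
Local Open Scope ring_scope.

(** Put [y m = sigma^m(q)], and let [F], [G] be polynomial maps inducing [sigma]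
    and its inverse on [Y]. Then [y (m + 1) - y (m - 1) = (F - G)(y m)], so [y] is
    an orbit of the automorphism [(x, z) |-> (z, x + (F - G)(z))] of affine
    2N-space, whatever the singularities of [Y].

    Assume first that the coefficients lie in a torsion-free, [p]-adically
    separated ring [A] with [A / p] finite, [p] odd. Let [I] be the ideal
    generated by [p] and the [x_i - x_i(0)]. Modulo [I^2] the orbit takes finitely
    many values, so it has a period [b] bounded only in terms of [#|A / p|] and
    [N]. The difference operator of step [b] therefore maps [I^k] into [I^(k+1)],
    so the [k]-th difference of a polynomial function along the orbit is
    divisible by [p^k]. As [2 v_p(k!) <= k], such a sequence is approximated by
    polynomials whose high coefficients are divisible by high powers of [p];
    dividing by the factors [x - n] for its zeros [n] shows that it vanishes
    identically as soon as it has infinitely many zeros (Strassmann).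

    In general no embedding into one such ring is needed: it suffices that
    homomorphisms to such rings, with a common bound on [#|A / p|], separate the
    elements of a finitely generated subring of [K]. This is proved along a tower
    of simple extensions of the prime field. An algebraic [c] is sent to the class
    of [X] modulo its minimal polynomial; a transcendental [c], where a monic
    denominator [v(c)] must become invertible, to the class of [X] modulo
    [(X - s) v(X) - 1], and varying the integer [s] separates polynomials in [c]. *)

(** * Sequences with divisible differences *)

Definition multiple_of (V : nmodType) (n : nat) (x : V) := exists y, x = y *+ n.

Section MultipleOf.
Variable A : comNzRingType.
Implicit Types (n : nat) (a b : A).

Lemma multiple_of0 n : multiple_of n (0 : A).
Proof. by exists 0; rewrite mul0rn. Qed.

Lemma multiple_ofD n a b :
  multiple_of n a -> multiple_of n b -> multiple_of n (a + b).
Proof. by move=> [x ->] [y ->]; exists (x + y); rewrite mulrnDl. Qed.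

Lemma multiple_ofMl n a b : multiple_of n b -> multiple_of n (a * b).
Proof. by move=> [x ->]; exists (a * x); rewrite mulrnAr. Qed.

Lemma multiple_ofM n m a b :
  multiple_of n a -> multiple_of m b -> multiple_of (n * m) (a * b).
Proof.
by move=> [x ->] [y ->]; exists (x * y); rewrite mulrnAl mulrnAr -mulrnA mulnC.
Qed.

Lemma multiple_of_dvd n m a : (n %| m)%N -> multiple_of m a -> multiple_of n a.
Proof. by move=> /dvdnP[k ->] [x ->]; exists (x *+ k); rewrite mulrnA. Qed.

Lemma multiple_of_sum n (I : Type) (r : seq I) (P : pred I) (F : I -> A) :
  (forall i, P i -> multiple_of n (F i)) ->
  multiple_of n (\sum_(i <- r | P i) F i).
Proof.
move=> nF; apply: (big_ind (@multiple_of A n)) => //; first exact: multiple_of0.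
by move=> x y; apply: multiple_ofD.
Qed.

(** By Bezout, some multiple of [q] is 1 modulo [n]; for [n = 0] coprimality means [q = 1]. *)
Lemma multiple_of_coprime n q a :
  coprime n q -> multiple_of n (a *+ q) -> multiple_of n a.
Proof.
case: n => [|n] co [x ax].
  by move: co; rewrite /coprime gcd0n => /eqP q1; exists x; rewrite -ax q1.
have [u v uv _] := egcdnP q (ltn0Sn n); move: uv; rewrite (eqP co) => uv.
exists (a *+ u - x *+ v); rewrite mulrnBl -!mulrnA uv mulrnDr mulr1n.
by rewrite [(v * q)%N]mulnC [(v * n.+1)%N]mulnC !mulrnA ax addrAC subrr add0r.
Qed.

End MultipleOf.

Definition fdiff (V : zmodType) (u : nat -> V) : nat -> V :=
  fun n => u n.+1 - u n.

(** Newton's forward difference formula, from Pascal's rule and [u n.+1 = u n + fdiff u n]. Terms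
    with [i > n] vanish, so any [d > n] serves. *)
Lemma newton_expansion (V : zmodType) (n d : nat) (u : nat -> V) :
  (n < d)%N -> u n = \sum_(i < d) iter i (@fdiff V) u 0%N *+ 'C(n, i).
Proof.
elim: n d u => [|n IH] [//|d] u ltnd.
  by rewrite big_ord_recl bin0 mulr1n big1 ?addr0.
have -> : u n.+1 = u n + fdiff u n by rewrite /fdiff addrC subrK.
rewrite (IH d.+1 u) ?(ltnW ltnd) // (IH d (fdiff u)) // !big_ord_recl !bin0.
rewrite -addrA; congr (_ + _); rewrite -big_split; apply: eq_bigr => i _ /=.
by rewrite binS mulrnDr /bump /= add1n -iterS iterSr.
Qed.

(** Legendre's formula bounds the valuation of [i!] by [i / (p - 1)], and [p - 1 >= 2]: this is
    where [p] must be odd. *)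
Lemma fact_pdecomp (p i : nat) : prime p -> (2 < p)%N ->
  exists v m, [/\ coprime p m, (v.*2 <= i)%N & (i`! = m * p ^ v)%N].
Proof.
move=> pp p3; have [m com im] := pfactor_coprime pp (fact_gt0 i).
exists (logn p i`!), m; split => //; rewrite logn_fact //.
(* The length of the sum is separated from the number being divided, so that the induction can pass
   from [n] to [n %/ p]. *)
elim: {im}i {2 3}i => [|K IH] n; first by rewrite big_nil.
rewrite big_nat_recl //= expn1.
have : ((\sum_(1 <= k < K.+1) (n %/ p) %/ p ^ k).*2 <= n %/ p)%N by exact: IH.
under [X in (_ + X)%N]eq_big_nat => k _ do rewrite expnS divnMA.
have := leq_trunc_div n p; move: (\sum_(_ <= _ < _) _)%N => s.
move: (n %/ p)%N => t tp st; rewrite -muln2.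
have : (t * 3 <= t * p)%N by rewrite leq_mul2l p3 orbT.
lia.
Qed.

(** * Strassmann's argument for Newton series *)

Section Strassmann.
Variables (A : comNzRingType) (p : nat).
Hypotheses (pr_p : prime p) (p_gt2 : (2 < p)%N).
Hypothesis A_torsion_free : forall (a : A) n, a *+ n.+1 = 0 -> a = 0.
Hypothesis A_separated : forall a : A, (forall k, multiple_of (p ^ k) a) -> a = 0.

Definition falling_poly (i : nat) : {poly A} := \prod_(l < i) ('X - l%:R%:P).

Lemma horner_falling_poly i n : (falling_poly i).[n%:R] = (n ^_ i)%:R.
Proof.
rewrite /falling_poly; elim: i => [|i IH].
  by rewrite big_ord0 hornerC.
rewrite big_ord_recr /= hornerM IH hornerXsubC ffactnSr.
have [lein|ltni] := leqP i n; first by rewrite natrM natrB.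
by rewrite ffact_small // mul0r mul0n.
Qed.

Lemma size_falling_poly i : size (falling_poly i) = i.+1.
Proof. by rewrite /falling_poly size_prod_XsubC /index_enum -enumT size_enum_ord. Qed.

(** The binomial coefficient is a falling factorial over [i!], which costs at most half of the
    factor [p ^ i]. The prime-to-[p] parts of the factorials are collected in [q] instead of being
    inverted in [A]. *)
Lemma newton_poly (c : nat -> A) (d : nat) : exists q (W : {poly A}),
  [/\ coprime p q, forall j, multiple_of (p ^ uphalf j) W`_j &
   forall n, W.[n%:R] = (\sum_(i < d) c i *+ p ^ i *+ 'C(n, i)) *+ q].
Proof.
elim: d => [|d [q [W [coq cW Wn]]]].
  exists 1%N, 0; split=> [|j|n]; first exact: coprimen1.
    by rewrite coef0; apply: multiple_of0.
  by rewrite horner0 big_ord0 mul0rn.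
have [v [m [com vd dE]]] := fact_pdecomp d pr_p p_gt2.
(* As [d! = m * p ^ v], the new term scaled by [q * m] is [e] times the falling factorial of length
   [d]. *)
pose e := c d *+ q *+ p ^ (d - v).
exists (q * m)%N, (W *+ m + e *: falling_poly d); split=> [|j|n].
- by rewrite coprimeMr coq.
- rewrite coefD coefMn coefZ; apply: multiple_ofD.
    by have [y ->] := cW j; exists (y *+ m); rewrite mulrnAC.
  have [ltdj|lejd] := ltnP d j.
    by rewrite [_`_j]nth_default ?size_falling_poly // mulr0; apply: multiple_of0.
  rewrite mulrC; apply: multiple_ofMl.
  apply: (@multiple_of_dvd _ _ (p ^ (d - v))); last by exists (c d *+ q).
  by rewrite dvdn_exp2l //; lia.
rewrite hornerD hornerMn Wn hornerZ horner_falling_poly big_ord_recr /=.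
rewrite mulrnDl -mulrnA; congr (_ + _).
rewrite mulr_natr /e -bin_ffact dE -!mulrnA; congr (_ *+ _).
have -> : (p ^ d = p ^ (d - v) * p ^ v)%N by rewrite -expnD subnK //; lia.
by ring.
Qed.

(** Synthetic division: each coefficient of the quotient is a coefficient of [W] one index higher
    plus [a] times the next quotient coefficient, so descending induction shifts the divisibility by
    one. *)
Lemma divide_root (W : {poly A}) (a : A) (e : nat) : root W a ->
  (forall j, multiple_of (p ^ uphalf (j + e)) W`_j) ->
  exists W', W = W' * ('X - a%:P) /\
    forall j, multiple_of (p ^ uphalf (j + e.+1)) W'`_j.
Proof.
move=> /factor_theorem[W' ->] cW; exists W'; split=> // j.
have rec i : W'`_i = (W' * ('X - a%:P))`_i.+1 + a * W'`_i.+1.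
  by rewrite mulrBr coefB coefMX coefMC /= mulrC subrK.
have [k] := ubnP (size W' - j)%N; elim: k j => // k IH j ltk.
have [sj|js] := leqP (size W') j.
  by rewrite nth_default //; apply: multiple_of0.
rewrite rec; apply: multiple_ofD; first by have := cW j.+1; rewrite addSnnS.
apply: multiple_ofMl; apply: (@multiple_of_dvd _ _ (p ^ uphalf (j.+1 + e.+1))).
  by rewrite dvdn_exp2l // uphalf_leq // leq_add2r.
by apply: IH; lia.
Qed.

Lemma natr_inj (a b : nat) (x : A) : a <> b -> x * (a%:R - b%:R) = 0 -> x = 0.
Proof.
wlog lab : a b / (a < b)%N.
  move=> th ne e0; have [l|l|//] := ltngtP a b; first exact: th l ne e0.
  by apply: (th b a l (nesym ne)); rewrite -opprB mulrN e0 oppr0.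
move=> _; rewrite -opprB -natrB ?(ltnW lab) // mulrN => /eqP.
rewrite oppr_eq0 mulr_natr => /eqP.
by rewrite -(@prednK (b - a)) ?subn_gt0 //; apply: A_torsion_free.
Qed.

(** Each root divided out raises [e] by one; once none is left, every coefficient carries the
    claimed power of [p]. *)
Lemma poly_many_roots (s : seq nat) (W : {poly A}) (e : nat) : uniq s ->
  (forall n, n \in s -> W.[n%:R] = 0) ->
  (forall j, multiple_of (p ^ uphalf (j + e)) W`_j) ->
  forall x, multiple_of (p ^ uphalf (e + size s)) W.[x].
Proof.
elim: s W e => [|a s IH] W e /= => [_ _ cW x | /andP[as_ us] rW cW x].
  rewrite horner_coef addn0; apply: multiple_of_sum => i _.
  rewrite mulrC; apply: multiple_ofMl; apply: multiple_of_dvd (cW i).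
  by rewrite dvdn_exp2l // uphalf_leq // leq_addl.
have /divide_root - /(_ e cW)[W' [WE cW']] : root W a%:R.
  by apply/rootP/rW; rewrite mem_head.
rewrite WE hornerM mulrC; apply: multiple_ofMl; rewrite addnS -addSn.
apply: IH => // n ns; apply: (@natr_inj n a); first by move=> na; rewrite -na ns in as_.
by rewrite -hornerXsubC -hornerM -WE rW // inE ns orbT.
Qed.

Lemma strassmann (u : nat -> A) :
  (forall i, multiple_of (p ^ i) (iter i (@fdiff A) u 0%N)) ->
  (forall C, exists2 n, (C <= n)%N & u n = 0) -> forall n, u n = 0.
Proof.
move=> du zu n; have [c cE] := choice du.
apply: A_separated => k.
(* Each root gains half a power of [p], so [2k] zeros yield [p ^ k]. *)
have [s [us ss zs]] : exists s, [/\ uniq s, size s = k.*2 & forall m, m \in s -> u m = 0].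
  elim: {n}k.*2 => [|l [s [us ss zs]]]; first by exists [::].
  have [m lm zm] := zu (\max_(i <- s) i).+1.
  exists (m :: s); split=> /=; [rewrite us andbT|by rewrite ss|].
    by apply/negP => ms; have := leq_trans lm (leq_bigmax_seq m ms isT); rewrite ltnn.
  by move=> i; rewrite inE => /predU1P[->|/zs].
(* [W] is known to agree with [u *+ q] only below [d], so [d] must exceed [n] and all chosen
   zeros. *)
pose d := (maxn n (\max_(i <- s) i)).+1.
have [q [W [coq cW Wn]]] := newton_poly c d.
have WE i : (i < d)%N -> W.[i%:R] = u i *+ q.
  move=> lid; rewrite Wn (newton_expansion u lid); congr (_ *+ _).
  by apply: eq_bigr => l _; rewrite cE.
apply: (@multiple_of_coprime _ _ q).
  by case: (k) => [|k']; rewrite ?expn0 ?coprime1n // coprime_pexpl.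
rewrite -WE ?ltnS ?leq_maxl //.
have -> : k = uphalf (0 + size s) by rewrite add0n ss uphalf_double.
apply: poly_many_roots => // [m ms|j]; last by rewrite addn0.
rewrite WE ?zs ?mul0rn // ltnS leq_max; apply/orP; right.
exact: leq_bigmax_seq.
Qed.

End Strassmann.

(** * Reversible polynomial recurrences *)

(** Completeness is not part of this, so the integers localized at [p] qualify; [M] bounds the
    number of residue classes modulo [p]. *)
Definition padic_ring (p M : nat) (A : comNzRingType) : Prop :=
  [/\ prime p, (2 < p)%N,
      forall (a : A) n, a *+ n.+1 = 0 -> a = 0,
      forall a : A, (forall k, multiple_of (p ^ k) a) -> a = 0 &
      exists t : 'I_M -> A, forall a, exists i, multiple_of p (a - t i)].

Section PointwiseOperations.
Variables (A : comNzRingType) (f g : nat -> A) (n : nat).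
Lemma seq_addE : (f + g) n = f n + g n. Proof. by []. Qed.
Lemma seq_oppE : (- f) n = - f n. Proof. by []. Qed.
Lemma seq_mulE : (f * g) n = f n * g n. Proof. by []. Qed.
Lemma seq_0E : (0 : nat -> A) n = 0. Proof. by []. Qed.
End PointwiseOperations.
Definition seqE := (seq_addE, seq_oppE, seq_mulE, seq_0E).

Section IdealPower.
Variables (A : comNzRingType) (J : Type) (G : J -> nat -> A).

(* [ideal_power i] contains the i-th power of the ideal generated by the [G j]
   in the ring of sequences generated by the [G j] and the constants. *)
Inductive ideal_power : nat -> (nat -> A) -> Prop :=
| ideal_power_cst a : ideal_power 0 (fun=> a)
| ideal_power_gen j : ideal_power 1 (G j)
| ideal_power_0 i : ideal_power i 0
| ideal_power_add i f g :
    ideal_power i f -> ideal_power i g -> ideal_power i (f + g)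
| ideal_power_mul i k f g :
    ideal_power i f -> ideal_power k g -> ideal_power (i + k) (f * g)
| ideal_power_weaken i f : ideal_power i.+1 f -> ideal_power i f.

Lemma ideal_power_le i k f : (k <= i)%N -> ideal_power i f -> ideal_power k f.
Proof.
move=> /subnK <-; elim: (i - k)%N => // n IH.
by rewrite addSn => /ideal_power_weaken.
Qed.

Lemma ideal_power_opp i f : ideal_power i f -> ideal_power i (- f).
Proof.
move=> /(ideal_power_mul (ideal_power_cst (- 1))); rewrite add0n.
by congr ideal_power; apply/funext => n; rewrite !seqE mulN1r.
Qed.

Lemma ideal_power_sum i (I : Type) (r : seq I) (F : I -> nat -> A) :
  (forall x, ideal_power i (F x)) -> ideal_power i (\sum_(x <- r) F x).
Proof.
move=> IF; apply: (big_ind (ideal_power i)) => //; first exact: ideal_power_0.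
exact: ideal_power_add.
Qed.

Lemma ideal_power_multiple (p i : nat) (f : nat -> A) :
  (forall j, multiple_of p (G j 0%N)) -> ideal_power i f ->
  multiple_of (p ^ i) (f 0%N).
Proof.
move=> pG; elim => {i f} [a|j|i|i f g _ If _ Ig|i k f g _ If _ Ig|i f _ If].
- by exists a.
- by rewrite expn1.
- exact: multiple_of0.
- exact: multiple_ofD.
- by rewrite expnD; apply: multiple_ofM.
- by apply: multiple_of_dvd If; rewrite expnS dvdn_mull.
Qed.

(** The difference operator is a twisted derivation: raising the degree on the generators is enough
    to raise it everywhere. *)
Lemma ideal_power_diff i f : (forall j, ideal_power 2 (fdiff (G j))) ->
  ideal_power i f -> ideal_power i.+1 (fdiff f).
Proof.
move=> dG; elim => {i f} [a|j|i|i f g _ If _ Ig|i k f g If dIf Ig dIg|i f _ If].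
- rewrite (_ : fdiff _ = 0); first exact: ideal_power_0.
  by apply/funext => n; rewrite /fdiff !seqE subrr.
- exact: dG.
- rewrite (_ : fdiff _ = 0); first exact: ideal_power_0.
  by apply/funext => n; rewrite /fdiff !seqE subrr.
- rewrite (_ : fdiff _ = fdiff f + fdiff g); first exact: ideal_power_add.
  by apply/funext => n; rewrite /fdiff !seqE; ring.
(* Twisted Leibniz rule, where [g + fdiff g] is the shift of [g]. *)
- rewrite (_ : fdiff _ = fdiff f * (g + fdiff g) + f * fdiff g).
    apply: ideal_power_add; last by rewrite -addnS; apply: ideal_power_mul.
    rewrite -addSn; apply: ideal_power_mul => //; apply: ideal_power_add => //.
    exact: ideal_power_weaken.
  by apply/funext => n; rewrite /fdiff !seqE; ring.
- exact: ideal_power_weaken.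
Qed.

Lemma ideal_power_iter_diff i f : (forall j, ideal_power 2 (fdiff (G j))) ->
  ideal_power 0 f -> ideal_power i (iter i (@fdiff A) f).
Proof. by move=> dG If; elim: i => //= i; apply: ideal_power_diff. Qed.

Definition cong2 (f g : nat -> A) := ideal_power 2 (f - g).

Lemma cong2_sym f g : cong2 f g -> cong2 g f.
Proof. by rewrite /cong2 -(opprB f) => /ideal_power_opp. Qed.

Lemma cong2_trans g f h : cong2 f g -> cong2 g h -> cong2 f h.
Proof.
by move=> fg /(ideal_power_add fg); rewrite /cong2 addrA subrK.
Qed.

Lemma cong2D f g f' g' : cong2 f g -> cong2 f' g' -> cong2 (f + f') (g + g').
Proof.
by rewrite /cong2 => fg /(ideal_power_add fg); rewrite opprD addrACA.
Qed.

Lemma cong2B f g f' g' : cong2 f g -> cong2 f' g' -> cong2 (f - f') (g - g').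
Proof.
move=> fg /ideal_power_opp; by rewrite opprD; apply: cong2D.
Qed.

Definition meval_seq (N : nat) (h : {mpoly A[N]}) (X : 'I_N -> nat -> A) :=
  fun n => h.@[fun j => X j n].

Lemma mpoly_ring_ind (N : nat) (P : {mpoly A[N]} -> Prop) :
  (forall c, P c%:MP) -> (forall i, P 'X_i) ->
  (forall h k, P h -> P k -> P (h + k)) ->
  (forall h k, P h -> P k -> P (h * k)) -> forall h, P h.
Proof.
move=> PC PX PD PM; elim/mpolyind => [|c m h _ _ Ph]; first by rewrite -mpolyC0.
apply: (PD) => //; rewrite -mul_mpolyC; apply: (PM) => //.
rewrite mpolyXE_id; apply: (big_ind P) => [||i _]; [by rewrite -mpolyC1|by []|].
elim: (m i) => [|n IH]; first by rewrite expr0 -mpolyC1.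
by rewrite exprS; apply: PM.
Qed.

Lemma ideal_power_meval N (h : {mpoly A[N]}) X :
  (forall j, ideal_power 0 (X j)) -> ideal_power 0 (meval_seq h X).
Proof.
move=> IX; elim/mpoly_ring_ind: h => [c|i|h k Ih Ik|h k Ih Ik].
- rewrite (_ : meval_seq _ _ = fun=> c); first exact: ideal_power_cst.
  by apply/funext => n; rewrite /meval_seq mevalC.
- rewrite (_ : meval_seq _ _ = X i) //.
  by apply/funext => n; rewrite /meval_seq mevalXU.
- rewrite (_ : meval_seq _ _ = meval_seq h X + meval_seq k X).
    exact: ideal_power_add.
  by apply/funext => n; rewrite seqE /meval_seq mevalD.
- rewrite (_ : meval_seq _ _ = meval_seq h X * meval_seq k X).
    by rewrite -[0%N]/(0 + 0)%N; apply: ideal_power_mul.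
  by apply/funext => n; rewrite seqE /meval_seq mevalM.
Qed.

Lemma cong2_meval N (h : {mpoly A[N]}) X Y :
  (forall j, ideal_power 0 (X j)) -> (forall j, ideal_power 0 (Y j)) ->
  (forall j, cong2 (X j) (Y j)) -> cong2 (meval_seq h X) (meval_seq h Y).
Proof.
move=> IX IY XY; elim/mpoly_ring_ind: h => [c|i|h k Ih Ik|h k Ih Ik].
- rewrite /cong2 (_ : _ - _ = 0); first exact: ideal_power_0.
  by apply/funext => n; rewrite !seqE /meval_seq !mevalC subrr.
- rewrite /cong2 (_ : _ - _ = X i - Y i); first exact: XY.
  by apply/funext => n; rewrite !seqE /meval_seq !mevalXU.
- rewrite /cong2 (_ : _ - _ = (meval_seq h X - meval_seq h Y) +
    (meval_seq k X - meval_seq k Y)); first exact: ideal_power_add.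
  by apply/funext => n; rewrite !seqE /meval_seq !mevalD; ring.
- rewrite /cong2 (_ : _ - _ = (meval_seq h X - meval_seq h Y) * meval_seq k X +
    meval_seq h Y * (meval_seq k X - meval_seq k Y)).
    apply: ideal_power_add.
      by rewrite -[2%N]addn0; apply: ideal_power_mul => //; apply: ideal_power_meval.
    by rewrite -[2%N]add0n; apply: ideal_power_mul => //; apply: ideal_power_meval.
  by apply/funext => n; rewrite !seqE /meval_seq !mevalM; ring.
Qed.

End IdealPower.

(** * Finitely many classes modulo the squared ideal *)

Section FiniteQuotient.
Variables (A : comNzRingType) (J : finType) (G : J -> nat -> A) (p M : nat).
Variables (j0 : J) (t : 'I_M -> A).
Hypothesis Gj0 : G j0 = fun=> p%:R.
Hypothesis tP : forall a, exists i, multiple_of p (a - t i).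

Definition linear_form (a0 : A) (a : J -> A) : nat -> A :=
  fun n => a0 + \sum_j a j * G j n.

Lemma ideal_power_linear a : ideal_power G 1 (linear_form 0 a).
Proof.
rewrite (_ : linear_form _ _ = \sum_j (fun=> a j) * G j).
  apply: ideal_power_sum => j; rewrite -[1%N]add0n.
  by apply: ideal_power_mul; [apply: ideal_power_cst | apply: ideal_power_gen].
by apply/funext => n; rewrite /linear_form add0r fct_sumE.
Qed.

(** The first-order Taylor expansion: in a product of two linear forms, the product of the two
    linear parts falls into the squared ideal. *)
Lemma cong2_linear_form i f : ideal_power G i f ->
  exists a0 a, cong2 G f (linear_form a0 a).
Proof.
have sub0 (g : nat -> A) k : g = 0 -> ideal_power G k g.
  by move=> ->; apply: ideal_power_0.
elim => {i f} [c|j|i|i f g _ [a0 [a fa]] _ [b0 [b gb]]|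
  i k f g If [a0 [a fa]] Ig [b0 [b gb]]|//].
- exists c, (fun=> 0); apply: sub0; apply/funext => n.
  by rewrite !seqE /linear_form big1 ?addr0 ?subrr // => j _; rewrite mul0r.
- exists 0, (fun i => (i == j)%:R); apply: sub0; apply/funext => n.
  rewrite !seqE /linear_form add0r (bigD1 j) //= eqxx mul1r big1 ?addr0 ?subrr //.
  by move=> i /negPf ->; rewrite mul0r.
- exists 0, (fun=> 0); apply: sub0; apply/funext => n.
  by rewrite !seqE /linear_form big1 ?addr0 ?subrr // => j _; rewrite mul0r.
- exists (a0 + b0), (fun j => a j + b j).
  have -> : linear_form (a0 + b0) (fun j => a j + b j) =
      linear_form a0 a + linear_form b0 b.
    apply/funext => n; rewrite !seqE /linear_form.
    under eq_bigr do rewrite mulrDl.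
    by rewrite big_split /=; ring.
  exact: cong2D.
- exists (a0 * b0), (fun j => a0 * b j + b0 * a j); rewrite /cong2.
  set F := linear_form (a0 * b0) _.
  rewrite (_ : _ - F = (f - linear_form a0 a) * g +
     linear_form a0 a * (g - linear_form b0 b) +
     linear_form 0 a * linear_form 0 b); last first.
    apply/funext => n; rewrite !seqE /F /linear_form.
    under eq_bigr do rewrite mulrDl -!mulrA.
    by rewrite big_split /= -!mulr_sumr; ring.
  have I0 c0 c : ideal_power G 0 (linear_form c0 c).
    have := ideal_power_add (ideal_power_cst G c0)
      (ideal_power_weaken (ideal_power_linear c)).
    by congr ideal_power; apply/funext => n; rewrite !seqE /linear_form add0r.
  apply: ideal_power_add; first apply: ideal_power_add.
  + rewrite -[2%N]addn0; apply: ideal_power_mul => //.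
    exact: ideal_power_le Ig.
  + by rewrite -[2%N]add0n; apply: ideal_power_mul.
  + by rewrite -[2%N]/(1 + 1)%N; apply: ideal_power_mul; apply: ideal_power_linear.
Qed.

(** Because [p] is itself a generator, the linear coefficients matter only modulo [p], and so does
    the constant term once its multiple of [p] is moved into the coefficient of [G j0]. *)
Lemma cong2_label f : ideal_power G 0 f ->
  exists l : 'I_M * {ffun J -> 'I_M},
    cong2 G f (linear_form (t l.1) (fun j => t (l.2 j))).
Proof.
move=> /cong2_linear_form[a0 [a fa]].
have [i0 [c0 a0E]] := tP a0.
(* The constant term is [t i0 + c0 * p], and [c0 * p] is [c0] times the generator [G j0]. *)
pose a' j := if j == j0 then a j + c0 else a j.
have [l lP] := choice (fun j => tP (a' j)).
have [c cE] := choice lP.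
exists (i0, finfun l); apply: cong2_trans fa _; rewrite /cong2 /=.
rewrite (_ : _ - _ = G j0 * linear_form 0 c); last first.
  apply/funext => n; rewrite !seqE /linear_form Gj0 add0r.
  rewrite opprD addrACA a0E -sumrB mulr_natl -sumrMnl.
  rewrite (bigD1 j0) //= [in RHS](bigD1 j0) //= addrA; congr (_ + _).
    rewrite ffunE -mulrBl -mulrnAl -cE /a' eqxx Gj0 -mulr_natr; ring.
  by apply: eq_bigr => j /negPf jj; rewrite ffunE -mulrBl -mulrnAl -cE /a' jj.
rewrite -[2%N]/(1 + 1)%N; apply: ideal_power_mul; last exact: ideal_power_linear.
exact: ideal_power_gen.
Qed.

End FiniteQuotient.

(* A pair of vectors of length N over the quotient by the squared ideal has at
   most this many values, whence the exponent of any permutation of such pairs. *)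
Definition uniform_period (M N : nat) : nat :=
  (#|{ffun bool * 'I_N -> 'I_M * {ffun option (bool * 'I_N) -> 'I_M}}|)`!%N.

Lemma uniform_period_gt0 M N : (0 < uniform_period M N)%N.
Proof. exact: fact_gt0. Qed.

(** * A uniform period and eventual nonvanishing *)

Section ReversibleRecurrence.
Variables (p M N : nat) (A : comNzRingType) (padicA : padic_ring p M A).
Variables (H : 'I_N -> {mpoly A[N]}) (y : nat -> 'I_N -> A).
Hypothesis recy : forall n j, y n.+2 j = y n j + (H j).@[y n.+1].

Local Notation b := (uniform_period M N).

(** The orbit sampled with step [b] from offset [k], so that [fdiff] compares points [b] apart. *)
Let V k j : nat -> A := fun n => y (b * n + k)%N j.
(** The ideal of the initial state modulo [p]; the boolean selects one of the two vectors [y 0],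
    [y 1] that determine the orbit. *)
Let G (o : option (bool * 'I_N)) : nat -> A :=
  if o is Some (c, j) then V c j - (fun=> y c j) else fun=> p%:R.

Let VS k j : V k.+2 j = V k j + meval_seq (H j) (V k.+1).
Proof. by apply/funext => n; rewrite seqE /meval_seq /V !addnS recy. Qed.

Let V0 k j : ideal_power G 0 (V k j).
Proof.
have Vb (c : bool) i : ideal_power G 0 (V c i).
  rewrite -(subrK (fun=> y c i) (V c i)); apply: ideal_power_add.
    by apply: ideal_power_weaken; apply: (@ideal_power_gen _ _ G (Some (c, i))).
  exact: ideal_power_cst.
suff: forall i, ideal_power G 0 (V k i) /\ ideal_power G 0 (V k.+1 i).
  by case/(_ j).
elim: k => [|k IH] i; first by split; [exact: (Vb false)|exact: (Vb true)].
split; first by have [] := IH i.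
rewrite VS; apply: ideal_power_add; first by have [] := IH i.
by apply: ideal_power_meval => j'; have [] := IH j'.
Qed.

(** Two consecutive offsets are compared because the recurrence has order two. *)
Let cong k l :=
  forall i, cong2 G (V k i) (V l i) /\ cong2 G (V k.+1 i) (V l.+1 i).

Let congS k l : cong k l -> cong k.+1 l.+1.
Proof.
move=> kl i; split; first by have [] := kl i.
rewrite !VS; apply: cong2D; first by have [] := kl i.
by apply: cong2_meval => j; [exact: V0|exact: V0|have [] := kl j].
Qed.

(** Reversibility: the recurrence can be solved for its earliest term. *)
Let congP k l : cong k.+1 l.+1 -> cong k l.
Proof.
move=> kl i; split; last by have [] := kl i.
have VP m : V m i = V m.+2 i - meval_seq (H i) (V m.+1) by rewrite VS addrK.
rewrite (VP k) (VP l); apply: cong2B; first by have [] := kl i.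
by apply: cong2_meval => j; [exact: V0|exact: V0|have [] := kl j].
Qed.

(** Among [s + 1] states two share a label. Reversibility moves this coincidence back to offset 0,
    giving a period at most [s], which divides [b], the factorial of [s]. *)
Let cong_period : cong b 0.
Proof.
have [_ _ _ _ [t tP]] := padicA.
have lab k : exists l : {ffun bool * 'I_N -> 'I_M * {ffun option (bool * 'I_N) -> 'I_M}},
    forall ci : bool * 'I_N, cong2 G (V (k + ci.1) ci.2)
      (linear_form G (t (l ci).1) (fun j => t ((l ci).2 j))).
  have [l lP] := choice (fun ci : bool * 'I_N =>
    @cong2_label A _ G p M None t erefl tP _ (V0 (k + ci.1) ci.2)).
  by exists (finfun l) => ci; rewrite ffunE.
have [l lP] := choice lab.
set s := #|{ffun bool * 'I_N -> 'I_M * {ffun option (bool * 'I_N) -> 'I_M}}|.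
have [k [m [km ms lkm]]] : exists k m : nat, [/\ (k < m)%N, (m <= s)%N & l k = l m].
  have /injectivePn[i [j ij lij]] : ~~ injectiveb (fun i : 'I_s.+1 => l i).
    by apply/injectiveP => /leq_card; rewrite card_ord -/s ltnn.
  have [||/val_inj ij'] := ltngtP i j; last by rewrite ij' eqxx in ij.
  - by exists i, j; split=> //; rewrite -ltnS.
  - by exists j, i; split=> //; rewrite -ltnS.
have ckm : cong m k.
  move=> i; have c2 (c : bool) : cong2 G (V (m + c) i) (V (k + c) i).
    apply: cong2_trans (lP m (c, i)) _; rewrite -lkm; apply: cong2_sym.
    exact: (lP k (c, i)).
  by split; [have := c2 false | have := c2 true]; rewrite ?addn0 ?addn1.
have {}ckm : cong (m - k) 0.
  move: ckm; rewrite -{1}(subnK (ltnW km)).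
  elim: {km ms lkm lab lP}k (m - k)%N => [|k IH] e; first by rewrite addn0.
  by rewrite addnS => /congP; apply: IH.
have shift e q : cong e 0 -> cong (q + e) q.
  by move=> e0; elim: q => // q IH; rewrite addSn; apply: congS.
have mul e q : cong e 0 -> cong (q * e) 0.
  move=> e0; elim: q => [|q IH] i.
    by split; rewrite /cong2 subrr; apply: ideal_power_0.
  have [u v] := shift e (q * e)%N e0 i; have [u' v'] := IH i.
  by rewrite mulSn addnC; split; apply: cong2_trans; eassumption.
have /dvdnP[q ->] : (m - k %| b)%N.
  by rewrite dvdn_fact // subn_gt0 km (leq_trans (leq_subr _ _)).
exact: mul.
Qed.

(** Unbounded zeros would let [strassmann] kill the value at 0; its divisibility hypothesis holds
    since all generators are multiples of [p] at index 0. *)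
Lemma recurrence_eventually_neq0 (f : {mpoly A[N]}) : f.@[y 0] != 0 ->
  exists C, forall n, (C <= n)%N -> f.@[y (b * n)%N] != 0.
Proof.
have [pr_p p_gt2 tf sep _] := padicA.
pose u := meval_seq f (V 0).
have uE n : u n = f.@[y (b * n)%N].
  by rewrite /u /meval_seq; apply: meval_eq => j; rewrite /V addn0.
move=> f0; apply: contrapT => nC.
have u0 : u 0%N = f.@[y 0%N] by rewrite uE muln0.
case/negP: f0; rewrite -u0; apply/eqP.
apply: (strassmann pr_p p_gt2 tf sep) => [i|C]; last first.
  apply: contrapT => nz; apply: nC; exists C => n Cn; apply/eqP => fn.
  by apply: nz; exists n; rewrite ?uE.
apply: (@ideal_power_multiple _ _ G) => [[[c j]|]|].
- by exists 0; rewrite /G !seqE /V muln0 add0n subrr mul0rn.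
- by exists 1.
apply: ideal_power_iter_diff => [[[c j]|]|].
(* The difference of a generator compares offsets [b + c] and [c], which [cong_period] makes
   congruent modulo the squared ideal. *)
- have dG : fdiff (G (Some (c, j))) = V (b + c) j - V c j.
    apply/funext => n; rewrite /fdiff !seqE opprB addrA subrK /V.
    by rewrite mulnS addnA [(b * n + b)%N]addnC.
  rewrite dG; case: (cong_period j) => c0 c1.
  by case: c {dG}; rewrite ?addn0 ?addn1.
- rewrite (_ : fdiff _ = 0); first exact: ideal_power_0.
  by apply/funext => n; rewrite /fdiff !seqE subrr.
by apply: ideal_power_meval => j; apply: V0.
Qed.

End ReversibleRecurrence.

(** * Specializations to p-adic rings *)

Section Plocal.
Variables (K : fieldType) (p : nat).

Definition plocal : {pred K} := fun x =>
  `[< exists (a : int) (d : nat), coprime p d /\ x * d%:R = a%:~R >].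

Lemma plocal_subring_closed : subring_closed plocal.
Proof.
split=> [|x y|x y].
- by apply/asboolP; exists 1, 1%N; rewrite coprimen1 mulr1.
- move=> /asboolP[a [d [cd xd]]] /asboolP[a' [d' [cd' yd']]]; apply/asboolP.
  exists (a * d'%:Z - a' * d%:Z), (d * d')%N; rewrite coprimeMr cd cd'; split=> //.
  by rewrite rmorphB !rmorphM /= -xd -yd' !pmulrn; ring.
- move=> /asboolP[a [d [cd xd]]] /asboolP[a' [d' [cd' yd']]]; apply/asboolP.
  exists (a * a'), (d * d')%N; rewrite coprimeMr cd cd'; split=> //.
  by rewrite !rmorphM /= -xd -yd'; ring.
Qed.

HB.instance Definition _ :=
  GRing.isSubringClosed.Build K plocal plocal_subring_closed.

Definition plocal_ring := {x : K | x \in plocal}.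
HB.instance Definition _ := SubChoice.on plocal_ring.
HB.instance Definition _ := [SubChoice_isSubComNzRing of plocal_ring by <:].

Hypothesis charK0 : [pchar K] =i pred0.
Hypotheses (pr_p : prime p) (p_gt2 : (2 < p)%N).

Let natr_eq0 n : (n%:R == 0 :> K) = (n == 0)%N.
Proof. exact: (pcharf0P K).1. Qed.

Let intr_eq0 (a : int) : a%:~R = 0 :> K -> a = 0.
Proof.
case: a => n; first by move=> /eqP; rewrite -pmulrn natr_eq0 => /eqP ->.
by rewrite NegzE mulrNz => /eqP; rewrite oppr_eq0 -pmulrn natr_eq0.
Qed.

Let coprime_natr d : coprime p d -> d%:R != 0 :> K.
Proof.
rewrite natr_eq0; apply: contraTneq => ->.
by rewrite /coprime gcdn0 neq_ltn prime_gt1 ?orbT.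
Qed.

Lemma plocal_padic : padic_ring p p plocal_ring.
Proof.
split=> // [x n /(congr1 val)|x xk|].
- rewrite raddfMn /= => /eqP; rewrite -mulr_natr mulf_eq0 natr_eq0 orbF.
  by move=> /eqP x0; apply: val_inj.
- have /asboolP[a [d [cd xd]]] := valP x.
  suff a0 : a = 0.
    apply: val_inj; apply/eqP; move: xd; rewrite a0 => /eqP.
    by rewrite mulf_eq0 (negPf (coprime_natr cd)) orbF.
  (* All powers of [p] divide the numerator, yet [p ^ |a|] exceeds [|a|] in size. *)
  have dvd k : (p ^ k %| `|a|)%N.
    have [y xy] := xk k; have /asboolP[a' [d' [cd' yd']]] := valP y.
    have : a * d'%:Z = (p ^ k)%:Z * (a' * d%:Z).
      apply/eqP; rewrite -subr_eq0; apply/eqP/intr_eq0.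
      rewrite rmorphB !rmorphM /= -xd -yd' xy raddfMn /= -!pmulrn.
      by rewrite -[_ *+ p ^ k]mulr_natr; ring.
    move=> /(congr1 absz); rewrite !abszM !absz_nat => e.
    have : (p ^ k %| `|a| * d')%N by rewrite e dvdn_mulr.
    by rewrite Gauss_dvdl // coprimeXl.
  apply/eqP; rewrite -absz_eq0; apply: contraT; rewrite -lt0n => a0.
  have := dvdn_leq a0 (dvd `|a|%N); rewrite leqNgt ltn_expl ?prime_gt1 //.
- exists (fun i : 'I_p => (i : nat)%:R) => x.
  have /asboolP[a [d [cd xd]]] := valP x.
  have d0 := coprime_natr cd.
  have dgt0 : (0 < d)%N by rewrite lt0n -natr_eq0.
  have [u v uv _] := egcdnP p dgt0.
  have p0 : (p%:Z != 0) by rewrite -lt0n prime_gt0.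
  move: uv; rewrite gcdnC (eqP cd) => uv.
  (* [u] inverts [d] modulo [p], so [r] represents the class of [x = a / d]; below, [e / d] is the
     quotient of [x - r] by [p]. *)
  pose r := modz (a * u%:Z) p%:Z.
  have r0 : 0 <= r by rewrite modz_ge0.
  have rp : (`|r| < p)%N by rewrite -ltz_nat gez0_abs // ltz_mod.
  exists (Ordinal rp) => /=.
  pose e := (divz (a * u%:Z) p%:Z) * d%:Z - a * v%:Z.
  have ed : e%:~R / d%:R \in plocal.
    by apply/asboolP; exists e, d; split=> //; rewrite divfK.
  have [z zE] : exists z : plocal_ring, \val z = e%:~R / d%:R.
    by exists (exist (fun x => x \in plocal) _ ed).
  exists z; apply: val_inj; rewrite [RHS]rmorphMn rmorphB rmorph_nat /= zE.
  rewrite pmulrn gez0_abs // -mulr_natr.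
  apply: (mulIf d0); rewrite mulrBl xd mulrAC divfK // !pmulrn.
  rewrite -!rmorphM -rmorphB /=; congr (_%:~R).
  have -> : r = a * u%:Z - divz (a * u%:Z) p%:Z * p%:Z.
    by apply: (canRL (addrK _)); rewrite addrC -divz_eq.
  have : u%:Z * d%:Z = v%:Z * p%:Z + 1 by rewrite -!PoszM uv PoszD.
  rewrite /e; move: (divz _ _) => w; rewrite mulrBl -mulrA => ->.
  by ring.
Qed.

End Plocal.

Lemma in_qpoly_val (A : comNzRingType) (h : {poly A}) (q : {poly %/ h}) :
  in_qpoly h q = q.
Proof. by apply: val_inj; apply: in_qpoly_small; apply: size_mk_monic. Qed.

(** The quotient is free over [A] on the powers of [X] below the degree, so every condition is
    checked coefficientwise. The new bound depends only on [M] and the degree. *)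
Lemma padic_qpoly (p M n : nat) (A : comNzRingType) (h : {poly A}) :
  padic_ring p M A -> h \is monic -> size h = n.+2 ->
  padic_ring p #|{ffun 'I_n.+1 -> 'I_M}| {poly %/ h}.
Proof.
move=> [pr_p p_gt2 tf sep [t tP]] mon_h size_h.
(* The quotient is taken by [mk_monic h], which differs from [h] when [h] is constant or not
   monic. *)
have hE : mk_monic h = h by rewrite /mk_monic size_h mon_h.
split=> // [q k qk|q qk|].
- apply/val_inj/polyP => i /=; rewrite coef0; apply: (tf _ k).
  by rewrite -coefMn -raddfMn qk raddf0 coef0.
- apply/val_inj/polyP => i /=; rewrite coef0; apply: sep => k.
  by have [q' ->] := qk k; rewrite raddfMn /= coefMn; exists (q'`_i).
exists (fun l : 'I_#|{ffun 'I_n.+1 -> 'I_M}| =>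
  in_qpoly h (\poly_(i < n.+1) t ((enum_val l : {ffun _}) (inord i)))) => q.
have [l lP] := choice (fun i => tP q`_i).
have [c cE] := choice lP.
exists (enum_rank [ffun i : 'I_n.+1 => l i]), (in_qpoly h (\poly_(i < n.+1) c i)).
rewrite -{1}(in_qpoly_val q) -raddfB -raddfMn; congr (in_qpoly h _).
apply/polyP => i; rewrite coefB coefMn !coef_poly.
have [ltin|lein] := ltnP i n.+1.
  by rewrite enum_rankK ffunE inordK // cE.
rewrite nth_default ?subr0 ?mul0rn // (leq_trans _ lein) // -ltnS.
by rewrite -size_h -{2}hE size_mk_monic.
Qed.

(** [p] and [A] may vary with [b], but [M] may not: the period depends on [M]. As [phi] kills the
    kernel of [j], it factors through the image of [j], so [j] need not be injective. *)
Definition padic_separated (K : fieldType) (M : nat) (B : comNzRingType)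
    (j : {rmorphism B -> K}) :=
  forall b, j b != 0 -> exists p (A : comNzRingType) (phi : {rmorphism B -> A}),
    [/\ padic_ring p M A, phi b <> 0 & forall b', j b' = 0 -> phi b' = 0].

(** The image of [B] is kept inside [F] so that minimality or transcendence over [F] applies to it
    when one more element is adjoined. *)
Definition padic_separable (K : fieldType) (F : {pred K}) :=
  forall L : seq K, {subset L <= F} ->
  exists M (B : comNzRingType) (j : {rmorphism B -> K}),
    [/\ forall b, j b \in F, forall l, l \in L -> exists b, j b = l &
        padic_separated M j].

(** * The prime field *)

Section PrimeField.
Variable K : fieldType.

Definition prime_field : {pred K} := fun x =>
  `[< exists (a : int) (d : nat), d%:R != 0 :> K /\ x * d%:R = a%:~R >].

Lemma prime_field_closed : divring_closed prime_field.
Proof.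
split=> [|x y|x y].
- by apply/asboolP; exists 1, 1%N; rewrite mulr1 oner_neq0.
- move=> /asboolP[a [d [d0 xd]]] /asboolP[a' [d' [d0' yd']]]; apply/asboolP.
  exists (a * d'%:Z - a' * d%:Z), (d * d')%N; rewrite natrM mulf_neq0 //; split=> //.
  by rewrite rmorphB !rmorphM /= -xd -yd' !pmulrn; ring.
- move=> /asboolP[a [d [d0 xd]]] /asboolP[a' [d' [d0' yd']]]; apply/asboolP.
  have [y0|y0] := eqVneq y 0.
    by exists 0, 1%N; rewrite y0 invr0 mulr0 mul0r oner_neq0.
  have an0 : a'%:~R != 0 :> K by rewrite -yd' mulf_neq0.
  (* Denominators are natural numbers, so on inversion the sign of [a'] has to move to the
     numerator. *)
  have sz : a' = (-1) ^+ (a' < 0)%R * `|a'|%N%:Z by rewrite -intEsign.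
  have absn0 : `|a'|%N%:R != 0 :> K.
    by apply: contraNneq an0 => e; rewrite sz rmorphM /= -pmulrn e mulr0.
  exists ((-1) ^+ (a' < 0)%R * a * d'%:Z), (d * `|a'|)%N; split.
    by rewrite natrM mulf_neq0.
  have -> : y = a'%:~R / d'%:R by rewrite -yd' mulfK.
  rewrite natrM !rmorphM /= -!pmulrn -xd {1}sz rmorphM /= -pmulrn.
  have [e | e] : (-1) ^+ (a' < 0)%R = 1 :> int \/ (-1) ^+ (a' < 0)%R = -1 :> int.
    by case: (a' < 0)%R; [right|left].
    by rewrite e; field; rewrite d0' absn0.
  by rewrite e; field; rewrite d0' absn0 oppr_eq0 oner_eq0.
Qed.

HB.instance Definition _ :=
  GRing.isDivringClosed.Build K prime_field prime_field_closed.

Lemma prime_field_common_denominator (L : seq K) : {subset L <= prime_field} ->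
  exists D, D%:R != 0 :> K /\ forall l, l \in L -> exists a : int, l * D%:R = a%:~R.
Proof.
elim: L => [|x L IH] sL; first by exists 1%N; rewrite oner_neq0.
have [|D [D0 LD]] := IH; first by move=> l lL; apply: sL; rewrite inE lL orbT.
have /asboolP[a [d [d0 xd]]] := sL x (mem_head _ _).
exists (d * D)%N; rewrite natrM mulf_neq0 //; split=> // l; rewrite inE.
case/predU1P => [->|/LD[a' la']].
  by exists (a * D%:Z); rewrite intrM -xd -pmulrn mulrA.
by exists (a' * d%:Z); rewrite intrM -la' -pmulrn; ring.
Qed.

(** For a prime [p] above a common denominator, the localization at [p] contains [L] and the
    identity separates its elements. *)
Lemma padic_separable_prime_field : [pchar K] =i pred0 ->
  padic_separable prime_field.
Proof.
move=> charK0 L /prime_field_common_denominator[D [Dn0 LD]].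
have D0 : (0 < D)%N by rewrite lt0n; apply: contraNneq Dn0 => ->.
have [p Dp pr_p] := prime_above (maxn 2 D); move: Dp; rewrite gtn_max => /andP[p2 Dp].
exists p, (plocal_ring K p), (\val : plocal_ring K p -> K).
split=> [x|l|x x0].
- have /asboolP[a [d [cd xd]]] := valP x; apply/asboolP; exists a, d; split=> //.
  rewrite (pcharf0P K).1 //; apply: contraTneq cd => ->.
  by rewrite /coprime gcdn0 neq_ltn prime_gt1 ?orbT.
- move=> /LD[a la].
  have lp : l \in plocal p.
    apply/asboolP; exists a, D; split=> //.
    by rewrite prime_coprime //; apply/negP => /(dvdn_leq D0); rewrite leqNgt Dp.
  by exists (exist (fun x => x \in plocal p) l lp : plocal_ring K p).
exists p, (plocal_ring K p), idfun; split; first exact: plocal_padic.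
  by move=> /= e; rewrite e raddf0 eqxx in x0.
by move=> y /= y0; apply: val_inj.
Qed.

End PrimeField.

(** * Adjoining one element to a subfield *)

Section Adjoin.
Variables (K : fieldType) (F : divringClosed K) (c : K).

Definition adjoin : {pred K} := fun x =>
  `[< exists u v : {poly K}, [/\ u \is a polyOver F, v \is a polyOver F,
        v.[c] != 0 & x = u.[c] / v.[c]] >].

Lemma adjoin_closed : divring_closed adjoin.
Proof.
split=> [|x y|x y].
- apply/asboolP; exists 1, 1; rewrite !polyOverC !rpred1 hornerC oner_eq0.
  by rewrite divr1.
- move=> /asboolP[u [v [uF vF v0 ->]]] /asboolP[u' [v' [uF' vF' v0' ->]]].
  apply/asboolP; exists (u * v' - u' * v), (v * v').
  rewrite rpredB ?rpredM //; split=> //; first by rewrite hornerM mulf_neq0.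
  by rewrite !(hornerM, hornerD, hornerN); field; rewrite v0 v0'.
move=> /asboolP[u [v [uF vF v0 ->]]] /asboolP[u' [v' [uF' vF' v0' ->]]].
apply/asboolP; have [e|ne] := eqVneq u'.[c] 0.
  exists 0, 1; rewrite !polyOverC rpred0 rpred1 !hornerC oner_eq0.
  by rewrite e !mul0r invr0 mulr0.
exists (u * v'), (v * u'); rewrite !rpredM //; split=> //.
  by rewrite hornerM mulf_neq0.
by rewrite !hornerM; field; rewrite v0 v0' ne.
Qed.

HB.instance Definition _ := GRing.isDivringClosed.Build K adjoin adjoin_closed.

Lemma sub_adjoin x : x \in F -> x \in adjoin.
Proof.
move=> xF; apply/asboolP; exists x%:P, 1; rewrite !polyOverC xF rpred1.
by rewrite !hornerC oner_eq0 divr1.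
Qed.

Lemma mem_adjoin : c \in adjoin.
Proof.
apply/asboolP; exists 'X, 1; rewrite polyOverX polyOverC rpred1.
by rewrite hornerX hornerC oner_eq0 divr1.
Qed.

Lemma adjoin_horner (u : {poly K}) (x : K) :
  u \is a polyOver F -> x \in adjoin -> u.[x] \in adjoin.
Proof.
move=> uF xF; apply: (@rpred_horner _ adjoin) => //.
by apply/polyOverP => i; apply/sub_adjoin/(polyOverP uF).
Qed.

End Adjoin.

Section Lift.
Variables (K : fieldType) (B : comNzRingType) (j : {rmorphism B -> K}).

Lemma lift_poly (u : {poly K}) : (forall x, x \in (u : seq K) -> exists b, j b = x) ->
  exists w : {poly B}, map_poly j w = u.
Proof.
move=> uj; have /choice[b bE] : forall i, exists b, j b = u`_i.
  move=> i; have [si|is_] := leqP (size u) i.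
    by exists 0; rewrite nth_default // raddf0.
  exact/uj/mem_nth.
exists (\poly_(i < size u) b i); apply/polyP => i; rewrite coef_map coef_poly.
by case: ltnP => si; [exact: bE | rewrite nth_default // raddf0].
Qed.

(** Under a non-injective [j], an arbitrary lift may have a leading coefficient other than 1. It is
    truncated below the degree of [u] and completed by a power of [X]. *)
Lemma lift_monic (u : {poly K}) : (forall x, x \in (u : seq K) -> exists b, j b = x) ->
  u \is monic ->
  exists w : {poly B}, [/\ map_poly j w = u, w \is monic & size w = size u].
Proof.
move=> uj mon_u; have [w wu] := lift_poly uj; pose n := (size u).-1.
have su : size u = n.+1 by rewrite prednK // size_poly_gt0 monic_neq0.
pose r := \poly_(i < n) w`_i.
have sr : (size r < size ('X^n : {poly B}))%N by rewrite size_polyXn ltnS size_poly.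
exists ('X^n + r); split.
- apply/polyP => i; rewrite -wu !coef_map coefD coefXn coef_poly /= rmorphD.
  rewrite rmorph_nat; case: (ltngtP i n) => [_|ni|->]; first by rewrite add0r.
    by rewrite add0r raddf0 -coef_map wu nth_default // su.
  rewrite [j 0]raddf0 addr0 -coef_map wu; have := monicP mon_u.
  by rewrite lead_coefE su /= => ->.
- by rewrite monicE lead_coefDl // lead_coefXn.
- by rewrite size_polyDl // size_polyXn.
Qed.

End Lift.

Lemma in_qpoly_neq0 (A : comNzRingType) (h u : {poly A}) :
  h \is monic -> (1 < size h)%N -> (size u < size h)%N -> u <> 0 ->
  in_qpoly h u <> 0.
Proof.
move=> mon_h sh su u0 /(congr1 (@qpoly.polyn _ _)); rewrite in_qpoly_small //.
by rewrite /mk_monic sh mon_h.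
Qed.

Lemma in_qpoly_modulus (A : comNzRingType) (h : {poly A}) :
  h \is monic -> (1 < size h)%N -> in_qpoly h h = 0.
Proof.
move=> mon_h sh; apply: val_inj; rewrite /= /mk_monic sh mon_h /=.
by rewrite Pdiv.RingMonic.rmodpp.
Qed.

Lemma map_poly_ker (B A : comNzRingType) (K : fieldType)
    (j : {rmorphism B -> K}) (phi : {rmorphism B -> A}) (u : {poly B}) :
  (forall b, j b = 0 -> phi b = 0) -> map_poly j u = 0 -> map_poly phi u = 0.
Proof.
move=> jphi ju; apply/polyP => i; rewrite coef_map coef0 /=; apply: jphi.
by rewrite -coef_map ju coef0.
Qed.

Lemma poly_neq0_coef (A : nzRingType) (u : {poly A}) :
  u != 0 -> exists i, u`_i != 0.
Proof. by move=> u0; exists (size u).-1; rewrite -lead_coefE lead_coef_eq0. Qed.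

(** * Algebraic elements *)

Section AlgebraicExtension.
Import Pdiv.CommonRing Pdiv.RingMonic.
Variables (K : fieldType) (F : divringClosed K) (c : K).

Lemma polyOver_divide (v u : {poly K}) : v != 0 ->
  v \is a polyOver F -> u \is a polyOver F ->
  exists a, a \is a polyOver F /\ (size (u - a * v)%R < size v)%N.
Proof.
move=> v0 vF; have [n] := ubnP (size u); elim: n u => // n IH u sun uF.
have [?|svu] := ltnP (size u) (size v); first by exists 0; rewrite rpred0 mul0r subr0.
have lv0 : lead_coef v != 0 by rewrite lead_coef_eq0.
have u0 : u != 0 by rewrite -size_poly_gt0 (leq_trans _ svu) // size_poly_gt0.
pose a := (lead_coef u / lead_coef v) *: 'X^(size u - size v) : {poly K}.
have aF : a \is a polyOver F.
  rewrite polyOverZ ?rpredX ?polyOverX // rpred_div // lead_coefE.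
    exact: (polyOverP uF).
  exact: (polyOverP vF).
have sav : size (a * v) = size u.
  have v_gt0 : (0 < size v)%N by rewrite size_poly_gt0.
  rewrite -scalerAl size_scale; last by rewrite mulf_neq0 ?invr_eq0 ?lead_coef_eq0.
  by rewrite mulrC size_mulXn // subnK.
have lav : lead_coef (a * v) = lead_coef u.
  by rewrite -scalerAl lead_coefZ lead_coefM lead_coefXn mul1r divfK.
have [||b [bF sb]] := IH (u - a * v).
- rewrite -ltnS; apply: leq_trans sun; rewrite ltnS.
  rewrite -[X in (_ < X)%N]prednK ?size_poly_gt0 //.
  rewrite ltnS; apply/leq_sizeP => i; rewrite leq_eqVlt => /predU1P[<-|si].
    by rewrite coefB -lead_coefE -sav -lead_coefE lav subrr.
  have {}si : (size u <= i)%N by rewrite -[size u]prednK // size_poly_gt0.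
  by rewrite coefB !nth_default ?subrr // sav.
- by rewrite rpredB // rpredM.
exists (a + b); rewrite rpredD //; split=> //.
by rewrite mulrDl opprD addrA.
Qed.

Variable P : {poly K}.
Hypotheses (PF : P \is a polyOver F) (mon_P : P \is monic) (Pc : P.[c] = 0).
Hypothesis min_P : forall u : {poly K},
  u \is a polyOver F -> u.[c] = 0 -> (size u < size P)%N -> u = 0.

Lemma size_minimal : (1 < size P)%N.
Proof.
have P0 := monic_neq0 mon_P; rewrite ltn_neqAle size_poly_gt0 P0 andbT eq_sym.
apply/negP => /eqP/eqP/size_poly1P[x x0 PE]; move: Pc.
by rewrite PE hornerC => /eqP; rewrite (negPf x0).
Qed.

(** Euclidean descent on [v]: it is reduced modulo [P], or replaced by the remainder of [P] modulo
    [v], whose value at [c] is a multiple of [v.[c]]. Should that remainder vanish at [c],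
    minimality makes [v] a factor of [P] and then a constant. *)
Lemma polyOver_inverse (v : {poly K}) : v \is a polyOver F -> v.[c] != 0 ->
  exists w, w \is a polyOver F /\ v.[c] * w.[c] = 1.
Proof.
have [n] := ubnP (size v); elim: n v => // n IH v svn vF vc.
have v0 : v != 0 by apply: contraNneq vc => ->; rewrite horner0.
have reduce b a : b \is a polyOver F -> a \is a polyOver F ->
    b.[c] = v.[c] * a.[c] -> b.[c] != 0 -> (size b < size v)%N ->
    exists w, w \is a polyOver F /\ v.[c] * w.[c] = 1.
  move=> bF aF bE b0 sb; have [|w [wF bw]] := IH b _ bF b0.
    by rewrite (leq_trans sb) // -ltnS.
  by exists (a * w); rewrite rpredM // hornerM mulrA -bE.
have [sPv|svP] := leqP (size P) (size v).
  have [a [aF sa]] := polyOver_divide (monic_neq0 mon_P) PF vF.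
  have bE : (v - a * P).[c] = v.[c] by rewrite hornerD hornerN hornerM Pc mulr0 subr0.
  apply: (reduce (v - a * P) 1); rewrite ?bE ?hornerC ?mulr1 //.
  - by rewrite rpredB // rpredM.
  - exact: rpred1.
  exact: leq_trans sa sPv.
have [a [aF sa]] := polyOver_divide v0 vF PF.
have bF : P - a * v \is a polyOver F by rewrite rpredB // rpredM.
have bE : (P - a * v).[c] = v.[c] * (- a).[c].
  by rewrite !(hornerD, hornerN, hornerM) Pc; ring.
have [b0|b0] := eqVneq (P - a * v).[c] 0; last first.
  by apply: reduce bE b0 sa => //; rewrite rpredN.
have PE : P = a * v.
  apply/eqP; rewrite -subr_eq0; apply/eqP/min_P => //; exact: ltn_trans sa svP.
have a0 : a != 0 by apply: contraNneq (monic_neq0 mon_P) => e; rewrite PE e mul0r.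
have ac : a.[c] = 0.
  by move/eqP: Pc; rewrite PE hornerM mulf_eq0 (negPf vc) orbF => /eqP.
have sv1 : size v = 1%N.
  apply/eqP; rewrite eqn_leq size_poly_gt0 v0 andbT leqNgt; apply/negP => sv.
  case/eqP: (a0); apply: min_P => //; rewrite PE size_mul //.
  by move: sv; case: (size v) => [|[|k]] // _; rewrite !addnS /= ltnS leq_addr.
have /size_poly1P[x x0 vE] : size v == 1%N by rewrite sv1.
exists (x^-1)%:P; rewrite vE !hornerC divff // polyOverC rpredV.
by have := polyOverP vF 0%N; rewrite vE coefC eqxx.
Qed.

(** Elements of the extension are polynomials in [c], lifted to [{poly B}]; the target rings are the
    quotients of [{poly A}] by the image of the minimal polynomial, all of the same degree. *)
Lemma padic_separable_algebraic : padic_separable F -> padic_separable (adjoin F c).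
Proof.
move=> sepF L sL.
have /choice[u uP] : forall l, exists u : {poly K},
    l \in L -> u \is a polyOver F /\ l = u.[c].
  move=> l; case: (boolP (l \in L)) => [lL|]; last by exists 0.
  have /asboolP[w [v [wF vF v0 ->]]] := sL l lL.
  have [z [zF vz]] := polyOver_inverse vF v0.
  exists (w * z) => _; rewrite rpredM //; split=> //.
  by rewrite hornerM; congr (_ * _); apply: (mulfI v0); rewrite vz divff.
pose L0 := (P : seq K) ++ flatten [seq (u l : seq K) | l <- L].
have [|M [B [j [jF jL sepB]]]] := sepF L0.
  move=> x; rewrite mem_cat => /orP[xP|/flattenP[s /mapP[l lL ->] xu]].
    by move/allP: PF; apply.
  by have [/allP uF _] := uP l lL; apply: uF.
have [h [hP mon_h sh]] : exists h : {poly B},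
    [/\ map_poly j h = P, h \is monic & size h = size P].
  by apply: lift_monic => // x xP; apply: jL; rewrite mem_cat xP.
have sP := size_minimal.
pose n := (size P).-2.
have sPn : size P = n.+2 by rewrite /n; case: (size P) sP => [|[]].
pose j' : {rmorphism {poly B} -> K} := horner_eval c \o map_poly j.
have jpF g : map_poly j g \is a polyOver F.
  by apply/polyOverP => i; rewrite coef_map /= jF.
(* As [P] vanishes at [c], only the remainder modulo the lift [h] counts. *)
have j'E g : j' g = (map_poly j (rmodp g h)).[c].
  rewrite {1}(rdivp_eq mon_h g) /j' /= /horner_eval.
  by rewrite rmorphD rmorphM /= hP hornerD hornerM Pc mulr0 add0r.
have srm g : (size (rmodp g h) < size P)%N by rewrite -sh ltn_rmodpN0 // monic_neq0.
have phi'E (A : comNzRingType) (phi : {rmorphism B -> A}) g :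
    in_qpoly (map_poly phi h) (map_poly phi g) =
    in_qpoly (map_poly phi h) (map_poly phi (rmodp g h)).
  rewrite {1}(rdivp_eq mon_h g) !rmorphD !rmorphM /=.
  rewrite in_qpoly_modulus ?mulr0 ?add0r ?monic_map //.
  by rewrite size_map_poly_id0 ?sh // (monicP mon_h) rmorph1 oner_eq0.
exists #|{ffun 'I_n.+1 -> 'I_M}|, {poly B}, j'; split=> [g|l lL|g].
- by rewrite /j' /= /horner_eval adjoin_horner // mem_adjoin.
- have [uF lE] := uP l lL; have [w wE] : exists w : {poly B}, map_poly j w = u l.
    apply: lift_poly => x xu; apply: jL; rewrite mem_cat; apply/orP; right.
    by apply/flattenP; exists (polyseq (u l)) => //; apply/mapP; exists l.
  by exists w; rewrite /j' /= /horner_eval wE -lE.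
rewrite j'E => g0.
have /poly_neq0_coef[i] : map_poly j (rmodp g h) != 0.
  by apply: contraNneq g0 => ->; rewrite horner0.
rewrite coef_map /= => /sepB[p [A [phi [padicA phi0 jphi]]]].
have mon_phi : map_poly phi h \is monic by rewrite monic_map.
have sphi : size (map_poly phi h) = n.+2.
  by rewrite size_map_poly_id0 ?sh // (monicP mon_h) rmorph1 oner_eq0.
exists p, {poly %/ map_poly phi h}, (in_qpoly (map_poly phi h) \o map_poly phi).
split=> [||b /= jb]; first exact: padic_qpoly.
- rewrite /= phi'E; apply: in_qpoly_neq0 => //; first by rewrite sphi.
    by rewrite sphi -sPn; apply: leq_ltn_trans (srm g); apply: size_poly.
  by move=> /(congr1 (fun v : {poly A} => v`_i)); rewrite coef_map coef0.
(* The remainder is too short to vanish at [c] unless its image is 0, and then [phi] kills its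
   coefficients. *)
rewrite phi'E (@map_poly_ker _ _ _ _ _ (rmodp b h) jphi) ?raddf0 //.
by apply: min_P; [exact: jpF|rewrite -j'E|apply: leq_ltn_trans (srm b); apply: size_poly].
Qed.

End AlgebraicExtension.

(** * Transcendental elements *)

Section ClearDenominator.
Variables (B C : comNzRingType) (psi : {rmorphism B -> C}) (w : B).

(** This is [g] evaluated at the inverse of [w], multiplied by [w ^+ size g] to stay in [B]. *)
Definition clear_denominator (g : {poly B}) : B :=
  \sum_(k < size g) g`_k * w ^+ (size g - k).

Lemma clear_denominatorE (y : C) (g : {poly B}) : psi w * y = 1 ->
  psi (clear_denominator g) = psi w ^+ size g * (map_poly psi g).[y].
Proof.
move=> wy; rewrite (horner_coef_wide _ (size_poly _ _)) mulr_sumr rmorph_sum.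
apply: eq_bigr => k _; rewrite coef_map /= rmorphM rmorphXn.
rewrite mulrCA; congr (_ * _).
have := ltnW (ltn_ord k); move: (nat_of_ord k) => i; move: (size g) => m im.
by rewrite -{2}(subnK im) exprD -mulrA -exprMn wy expr1n mulr1.
Qed.

Lemma clear_denominator_eq0 (y : C) (g : {poly B}) : psi w * y = 1 ->
  (map_poly psi g).[y] = 0 <-> psi (clear_denominator g) = 0.
Proof.
move=> wy; rewrite (clear_denominatorE _ wy); split=> [->|e]; first by rewrite mulr0.
by rewrite -[LHS]mul1r -(expr1n _ (size g)) -wy exprMn
 mulrAC e mul0r.
Qed.

End ClearDenominator.

Section ShiftedInverse.
Import Pdiv.CommonRing Pdiv.RingMonic.
Variables (A : comNzRingType) (p M n : nat) (V : {poly A}).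
Hypotheses (padicA : padic_ring p M A) (mon_V : V \is monic) (sV : size V = n.+1).

(* Modulo this monic polynomial, [V] has inverse ['X - s]. *)
Definition shifted_inverse_poly (s : nat) : {poly A} := ('X - s%:R%:P) * V - 1.

Local Notation Q := shifted_inverse_poly.

Let size_XV s : size (('X - s%:R%:P) * V) = n.+2.
Proof. by rewrite mulrC size_monicM ?polyXsubC_eq0 // size_XsubC sV addn2. Qed.

Let ltn_1XV s : (size (- 1 : {poly A})%R < size (('X - s%:R%:P) * V)%R)%N.
Proof. by rewrite size_polyN size_poly1 size_XV. Qed.

Lemma size_shifted_inverse_poly s : size (Q s) = n.+2.
Proof. by rewrite /Q size_polyDl ?ltn_1XV // size_XV. Qed.

Lemma monic_shifted_inverse_poly s : Q s \is monic.
Proof.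
rewrite monicE /Q lead_coefDl ?ltn_1XV // -monicE.
by rewrite rpredM // monicXsubC.
Qed.

Lemma shifted_inverse_polyP s :
  in_qpoly (Q s) V * in_qpoly (Q s) ('X - s%:R%:P) = 1.
Proof.
rewrite -in_qpolyM mulrC (_ : _ * V = Q s + 1); last by rewrite /Q subrK.
rewrite in_qpolyD in_qpoly1 in_qpoly_modulus ?add0r ?monic_shifted_inverse_poly //.
by rewrite size_shifted_inverse_poly.
Qed.

(** If [R] dies modulo every [Q s], it is divisible by the product of any number of them, which the
    degree forbids. Divisibility accumulates because each earlier [Q l] is a nonzerodivisor modulo
    [Q k]. *)
Lemma shifted_inverse_separates (R : {poly A}) : R <> 0 ->
  exists s, in_qpoly (Q s) R <> 0.
Proof.
move=> R0; apply: contrapT => nR.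
have Rs s : in_qpoly (Q s) R = 0 by apply: contrapT => e; apply: nR; exists s.
have Qk k : exists W, R = W * \prod_(s < k) Q s.
  elim: k => [|k [W RE]]; first by exists R; rewrite big_ord0 mulr1.
  suff : in_qpoly (Q k) W = 0.
    move=> /(congr1 (@qpoly.polyn _ _)) /=.
    rewrite /mk_monic size_shifted_inverse_poly monic_shifted_inverse_poly /=.
    move=> rW; exists (rdivp W (Q k)); rewrite big_ord_recr /= mulrCA [LHS]RE [LHS]mulrC.
    by rewrite {1}(rdivp_eq (monic_shifted_inverse_poly k) W) rW addr0.
  suff peel l U : (l <= k)%N -> in_qpoly (Q k) (U * \prod_(s < l) Q s) = 0 ->
      in_qpoly (Q k) U = 0 by apply: (peel k W (leqnn k)); rewrite -RE.
  elim: l U => [|l IH] U lk; first by rewrite big_ord0 mulr1.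
  rewrite big_ord_recr /= mulrA in_qpolyM => e.
  apply: (IH U (ltnW lk)).
  have [_ _ tf _ _] := padic_qpoly padicA (monic_shifted_inverse_poly k)
    (size_shifted_inverse_poly k).
  (* Modulo [Q k], the factor [Q l] is a nonzero integer times the unit [V], and the quotient is
     torsion-free. *)
  have QlE : Q l = Q k + V *+ (k - l).
    by rewrite /Q -[V *+ _]mulr_natl natrB ?(ltnW lk) // !polyC_natr; ring.
  have QlV : in_qpoly (Q k) (Q l) = in_qpoly (Q k) V *+ (k - l).
    rewrite QlE in_qpolyD in_qpoly_modulus ?monic_shifted_inverse_poly //.
      by rewrite add0r raddfMn.
    by rewrite size_shifted_inverse_poly.
  apply: (tf _ (k - l).-1); rewrite prednK ?subn_gt0 //.
  rewrite -[LHS]mulr1 -(shifted_inverse_polyP k) mulrA mulrnAl -mulrnAr -QlV e.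
  by rewrite mul0r.
(* With [size R] monic factors of positive degree the product is already longer than [R]. *)
have [W RE] := Qk (size R).
have W0 : W != 0 by apply: contra_not_neq R0 => e; rewrite RE e mul0r.
have : forall k, \prod_(s < k) Q s \is monic /\ (k < size (\prod_(s < k) Q s)%R)%N.
  elim=> [|k [mk sk]]; first by rewrite big_ord0 rpred1 size_poly1.
  rewrite big_ord_recr /= rpredM ?monic_shifted_inverse_poly //; split=> //.
  rewrite size_monicM ?monic_neq0 ?monic_shifted_inverse_poly //.
  by rewrite size_shifted_inverse_poly !addnS /= ltnS (leq_trans sk) // leq_addr.
move=> /(_ (size R))[mon_R]; rewrite ltnNge => /negP; apply.
rewrite [in X in (_ <= X)%N]RE mulrC size_monicM //.
have := W0; rewrite -size_poly_gt0; case: (size W) => // m _.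
by rewrite addnS leq_addr.
Qed.

End ShiftedInverse.

Section TranscendentalExtension.
Variables (K : fieldType) (F : divringClosed K) (c : K).
Hypothesis trans_c : forall u : {poly K}, u \is a polyOver F -> u.[c] = 0 -> u = 0.

(** Dividing by leading coefficients makes the denominator monic, as the moduli of
    [shifted_inverse_poly] require. *)
Lemma common_denominator (L : seq K) : {subset L <= adjoin F c} ->
  exists v : {poly K}, [/\ v \is a polyOver F, v \is monic &
    forall l, l \in L -> exists2 u, u \is a polyOver F & l = u.[c] / v.[c]].
Proof.
elim: L => [|x L IH] sL; first by exists 1; rewrite rpred1 monic1.
have [|v [vF mon_v vL]] := IH; first by move=> l lL; apply: sL; rewrite inE lL orbT.
have /asboolP[u' [w [uF' wF wc xE]]] := sL x (mem_head _ _).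
have w0 : w != 0 by apply: contraNneq wc => ->; rewrite horner0.
have nz u : u \is monic -> u \is a polyOver F -> u.[c] != 0.
  move=> mon_u uF; apply: contraTneq mon_u => /(trans_c uF) ->.
  by rewrite monicE lead_coef0 eq_sym oner_eq0.
pose a := (lead_coef w)^-1.
have a0 : a != 0 by rewrite invr_eq0 lead_coef_eq0.
have aF : a \in F by rewrite rpredV lead_coefE (polyOverP wF).
have mon_w : a *: w \is monic by rewrite monicE lead_coefZ mulVf ?lead_coef_eq0.
have awF : a *: w \is a polyOver F by rewrite polyOverZ.
have vc := nz v mon_v vF.
exists (a *: w * v); rewrite rpredM // rpredM //; split=> // l.
rewrite inE => /predU1P[->|/vL[u uF ->]].
  exists (a *: u' * v); first by rewrite rpredM // polyOverZ.
  by rewrite xE !hornerM !hornerZ; field; rewrite wc a0 vc.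
exists (a *: w * u); first by rewrite rpredM.
by rewrite !hornerM !hornerZ; field; rewrite wc a0 vc.
Qed.

Lemma padic_separable_transcendental :
  padic_separable F -> padic_separable (adjoin F c).
Proof.
move=> sepF L sL; have [v [vF mon_v vL]] := common_denominator sL.
have vc : v.[c] != 0.
  apply: contraTneq mon_v => /(trans_c vF) ->.
  by rewrite monicE lead_coef0 eq_sym oner_eq0.
have /choice[u uP] : forall l, exists u : {poly K},
    l \in L -> u \is a polyOver F /\ l = u.[c] / v.[c].
  move=> l; case: (boolP (l \in L)) => [/vL[u uF lE]|]; last by exists 0.
  by exists u.
pose L0 := (v : seq K) ++ flatten [seq (u l : seq K) | l <- L].
have [|M [B [j [jF jL sepB]]]] := sepF L0.
  move=> x; rewrite mem_cat => /orP[xP|/flattenP[s /mapP[l lL ->] xu]].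
    by move/allP: vF; apply.
  by have [/allP uF _] := uP l lL; apply: uF.
have [w [wv mon_w sw]] : exists w : {poly B},
    [/\ map_poly j w = v, w \is monic & size w = size v].
  by apply: lift_monic => // x xP; apply: jL; rewrite mem_cat xP.
pose n := (size w).-1.
have swn : size w = n.+1 by rewrite prednK // size_poly_gt0 monic_neq0.
have jpF g : map_poly j g \is a polyOver F.
  by apply/polyOverP => i; rewrite coef_map /= jF.
pose j1 : {rmorphism {poly B} -> K} := horner_eval c \o map_poly j.
pose y := v.[c]^-1.
have wy : j1 w * y = 1 by rewrite /j1 /= /horner_eval wv divff.
(* The inner variable stands for [c], the outer one for the inverse of [v.[c]]. *)
pose j' : {rmorphism {poly {poly B}} -> K} := horner_eval y \o map_poly j1.
have j'E g : j' g = (map_poly j1 g).[y] by [].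
have vF' : v.[c] \in adjoin F c by rewrite adjoin_horner // mem_adjoin.
exists #|{ffun 'I_n.+1 -> 'I_M}|, {poly {poly B}}, j'; split=> [g|l lL|g].
- rewrite [j' g]j'E; apply: (@rpred_horner _ (adjoin F c)); last by rewrite rpredV.
  apply/polyOverP => i; rewrite coef_map /= /horner_eval.
  by rewrite adjoin_horner // mem_adjoin.
- have [uF lE] := uP l lL; have [z zE] : exists z : {poly B}, map_poly j z = u l.
    apply: lift_poly => x xu; apply: jL; rewrite mem_cat; apply/orP; right.
    by apply/flattenP; exists (polyseq (u l)) => //; apply/mapP; exists l.
  exists (z%:P * 'X); rewrite j'E rmorphM /= map_polyC map_polyX.
  by rewrite hornerM hornerC hornerX /= /horner_eval zE [RHS]lE.
(* Once the denominator is cleared, transcendence of [c] turns vanishing at [c] into vanishing of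
   all coefficients. *)
have j'0 g' : j' g' = 0 <-> map_poly j (clear_denominator w g') = 0.
  rewrite j'E (clear_denominator_eq0 _ wy) /j1 /= /horner_eval.
  by split=> [/trans_c -> // | ->]; rewrite horner0.
move=> g0; have /poly_neq0_coef[i] : map_poly j (clear_denominator w g) != 0.
  by apply: contraNneq g0 => /j'0 ->.
rewrite coef_map /= => /sepB[p [A [phi [padicA phi0 jphi]]]].
pose V := map_poly phi w.
have mon_V : V \is monic by rewrite monic_map.
have sV : size V = n.+1.
  by rewrite size_map_poly_id0 ?swn // (monicP mon_w) rmorph1 oner_eq0.
(* [s] depends on [g], but the degree [n.+1] of the modulus, hence the bound on residues, does
   not. *)
have [|s sP] := @shifted_inverse_separates A p M n V padicA mon_V sV
    (map_poly phi (clear_denominator w g)).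
  by move=> /(congr1 (fun v : {poly A} => v`_i)); rewrite coef_map coef0.
pose Q := shifted_inverse_poly V s.
pose phi1 : {rmorphism {poly B} -> {poly %/ Q}} := in_qpoly Q \o map_poly phi.
pose y' := in_qpoly Q ('X - s%:R%:P).
have wy' : phi1 w * y' = 1 by exact: (shifted_inverse_polyP mon_V sV s).
pose phi' : {rmorphism {poly {poly B}} -> {poly %/ Q}} := horner_eval y' \o map_poly phi1.
have phi'0 g' : phi' g' = 0 <-> phi1 (clear_denominator w g') = 0.
  by rewrite -(clear_denominator_eq0 _ wy').
exists p, {poly %/ Q}, phi'; split=> [||b' /j'0 jb'].
- apply: padic_qpoly => //; first exact: (monic_shifted_inverse_poly mon_V sV s).
  exact: (size_shifted_inverse_poly mon_V sV s).
- by rewrite phi'0.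
by rewrite phi'0 /phi1 /= (map_poly_ker jphi jb') raddf0.
Qed.

End TranscendentalExtension.

Lemma padic_separable_adjoin (K : fieldType) (F : divringClosed K) (c : K) :
  padic_separable F -> padic_separable (adjoin F c).
Proof.
pose alg n := exists u : {poly K},
  [/\ u \is a polyOver F, u.[c] = 0, u != 0 & size u = n].
have [exn|nex] := pselect (exists n, alg n); last first.
  apply: padic_separable_transcendental => u uF uc.
  by apply/eqP; apply: contra_notT nex => u0; exists (size u), u.
have exb : exists n, `[< alg n >] by have [n nP] := exn; exists n; apply/asboolP.
have [m /asboolP[u [uF uc u0 su]] min_m] := ex_minnP exb.
have lu0 : lead_coef u != 0 by rewrite lead_coef_eq0.
apply: (@padic_separable_algebraic K F c ((lead_coef u)^-1 *: u)).
- by rewrite polyOverZ // rpredV lead_coefE (polyOverP uF).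
- by rewrite monicE lead_coefZ mulVf.
- by rewrite hornerZ uc mulr0.
move=> v vF vc; rewrite size_scale ?invr_eq0 // su ltnNge.
apply: contraNeq => v0; by apply: min_m; apply/asboolP; exists v.
Qed.

Lemma padic_specializations (K : fieldType) (L : seq K) : [pchar K] =i pred0 ->
  exists M (B : comNzRingType) (j : {rmorphism B -> K}),
    (forall l, l \in L -> exists b, j b = l) /\ padic_separated M j.
Proof.
move=> charK0.
have [F [sepF LF]] : exists F : divringClosed K, padic_separable F /\ {subset L <= F}.
  elim: L => [|c L [F [sepF LF]]].
    exists (GRing.DivringClosed.clone K (@prime_field K) _).
    by split; first exact: padic_separable_prime_field.
  exists (GRing.DivringClosed.clone K (adjoin F c) _).
  split; first exact: padic_separable_adjoin.
  move=> l; rewrite inE => /predU1P[->|/LF]; first exact: mem_adjoin.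
  exact: sub_adjoin.
by have [M [B [j [_ jL sepB]]]] := sepF L LF; exists M, B, j.
Qed.

(** * Orbits of automorphisms *)

Lemma meval_map_mpoly (N : nat) (A B : comNzRingType) (phi : {rmorphism A -> B})
    (h : {mpoly A[N]}) (v : 'I_N -> A) :
  (map_mpoly phi h).@[fun i => phi (v i)] = phi h.@[v].
Proof.
elim/mpoly_ring_ind: h => [c|i|h k Ih Ik|h k Ih Ik].
- by rewrite map_mpolyC !mevalC.
- by rewrite map_mpolyX !mevalXU.
- by rewrite [map_mpoly _ _]raddfD !mevalD Ih Ik rmorphD.
- by rewrite [map_mpoly _ _]rmorphM !mevalM Ih Ik rmorphM.
Qed.

Definition mpoly_coefs (N : nat) (A : nzRingType) (h : {mpoly A[N]}) : seq A :=
  [seq h@_m | m <- msupp h].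

Lemma lift_mpoly (N : nat) (K : fieldType) (B : comNzRingType)
    (j : {rmorphism B -> K}) (h : {mpoly K[N]}) :
  (forall x, x \in mpoly_coefs h -> exists b, j b = x) ->
  exists w : {mpoly B[N]}, map_mpoly j w = h.
Proof.
move=> hj; have /choice[b bE] : forall m, exists b, j b = h@_m.
  move=> m; have [mh|mh] := boolP (m \in msupp h); first exact/hj/map_f.
  by exists 0; rewrite raddf0 memN_msupp_eq0.
exists (\sum_(m <- msupp h) b m *: 'X_[m]).
rewrite [map_mpoly _ _]raddf_sum [RHS]mpolyE; apply: eq_bigr => m _ /=.
by rewrite map_mpolyZ map_mpolyX bE.
Qed.

(** The recurrence is assumed only after applying [j]; since [phi] kills the kernel of [j], it holds
    exactly in [A]. The period involves neither [p] nor [A], so it serves every [f] and every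
    orbit. *)
Lemma separated_recurrence_eventually_neq0 (K : fieldType) (M N : nat)
    (B : comNzRingType) (j : {rmorphism B -> K}) (H : 'I_N -> {mpoly B[N]})
    (f : {mpoly B[N]}) (y : nat -> 'I_N -> B) :
  padic_separated M j ->
  (forall n i, j (y n.+2 i) = j (y n i + (H i).@[y n.+1])) ->
  j f.@[y 0%N] != 0 ->
  exists C, forall n, (C <= n)%N -> j f.@[y (uniform_period M N * n)%N] != 0.
Proof.
move=> sepB recy /sepB[p [A [phi [padicA phif jphi]]]].
have [||C CP] := @recurrence_eventually_neq0 p M N A padicA
  (fun i => map_mpoly phi (H i)) (fun n i => phi (y n i)) _ (map_mpoly phi f).
- move=> n i; rewrite meval_map_mpoly -rmorphD; apply/eqP.
  by rewrite -subr_eq0 -rmorphB jphi // rmorphB recy subrr.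
- by rewrite meval_map_mpoly; apply/eqP.
exists C => n /CP; rewrite meval_map_mpoly; apply: contra_neq; exact: jphi.
Qed.

Lemma aut_iterS (K : fieldType) (N : nat) (Y : set {ffun 'I_N -> K})
    (sigma : automorphism Y) (m : int) (q : Y) :
  aut_iter sigma (m + 1) q = sigma (aut_iter sigma m q).
Proof.
case: m => [n|[|n]].
- by rewrite (_ : Posz n + 1 = Posz n.+1) // -addn1 PoszD.
- by rewrite (_ : Negz 0 + 1 = 0) //= aut_invK.
rewrite (_ : Negz n.+1 + 1 = Negz n); first by rewrite /= aut_invK.
by rewrite !NegzE -[n.+2]addn1 PoszD opprD addrNK.
Qed.

Lemma aut_iterP (K : fieldType) (N : nat) (Y : set {ffun 'I_N -> K})
    (sigma : automorphism Y) (m : int) (q : Y) :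
  aut_iter sigma (m - 1) q = aut_inv sigma (aut_iter sigma m q).
Proof. by rewrite -{2}(subrK 1 m) aut_iterS aut_funK. Qed.

(** A residue class modulo [b] either lies in [Z] or misses it at some point, and then meets it
    finitely often. *)
Lemma progressions_of_residues (Z : set int) (b : nat) : (0 < b)%N ->
  (forall r n0 : int, ~ Z (r + b%:Z * n0) ->
     exists C : nat, forall n : int, (C <= `|n|)%N -> ~ Z (r + b%:Z * (n0 + n))) ->
  exists (k : nat) (a c : 'I_k -> int) (F : set int),
    [/\ forall i, 1 <= c i, finite_set F &
        Z = (\bigcup_i complete_progression (a i) (c i)) `|` F].
Proof.
move=> b0 Zfin; pose good (r : nat) := forall n : int, Z (r%:Z + b%:Z * n).
have /choice[S SP] : forall r : nat, exists S : seq int,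
    ~ good r -> forall n : int, Z (r%:Z + b%:Z * n) -> r%:Z + b%:Z * n \in S.
  move=> r; have [gr|/existsNP[n0 nZ]] := pselect (good r); first by exists [::].
  have [C CP] := Zfin _ _ nZ.
  (* Members of [Z] in this class lie at distance less than [C] from [n0], and [k - C] runs over all
     such offsets. *)
  exists [seq r%:Z + b%:Z * (n0 + (k%:Z - C%:Z)) | k <- iota 0 (C + C)] => _ n Zn.
  have nC : (`|(n - n0)%R| < C)%N.
    by rewrite ltnNge; apply/negP => /CP; rewrite addrCA subrr addr0.
  apply/mapP; exists `|(n - n0 + C%:Z)%R|%N; first by rewrite mem_iota; lia.
  by congr (_ + _ * _); lia.
pose g := [seq r <- iota 0 b | `[< good r >]].
exists (size g), (fun i => (nth 0%N g i)%:Z), (fun=> b%:Z).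
exists (Z `&` [set` flatten [seq S r | r <- iota 0 b]]); split=> //.
  exact: sub_finite_set (@subIsetr _ _ _) (finite_seq _).
have goodg r : r \in g -> good r by rewrite mem_filter => /andP[/asboolP].
apply/seteqP; split=> [m Zm|m [[i _ [n ->]]|[]//]]; last first.
  exact/goodg/mem_nth.
pose r := `|modz m b%:Z|%N.
have rb : (r < b)%N by rewrite -ltz_nat gez0_abs ?modz_ge0 ?ltz_mod //; lia.
have mE : m = r%:Z + b%:Z * divz m b%:Z.
  by rewrite gez0_abs ?modz_ge0 1?addrC 1?mulrC -?divz_eq //; lia.
have [gr|ngr] := pselect (good r).
  have rg : r \in g by rewrite mem_filter mem_iota leq0n add0n rb !andbT; apply/asboolP.
  left; have ig : (index r g < size g)%N by rewrite index_mem.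
  by exists (Ordinal ig) => //; exists (divz m b%:Z); rewrite /= nth_index.
right; split=> //; apply/flattenP; exists (S r).
  by apply/mapP; exists r => //; rewrite mem_iota leq0n add0n rb.
by rewrite mE; apply: SP ngr _ _; rewrite -mE.
Qed.

Theorem theorem1p3 (K : fieldType) (charK0 : [pchar K] =i pred0) (N : nat)
    (Y : set {ffun 'I_N -> K}) (varY : affine_variety Y) (q : Y)
    (sigma : automorphism Y) (X : set {ffun 'I_N -> K}) (subX : subvariety Y X) :
  exists (k : nat) (a b : 'I_k -> int) (F : set int),
    [/\ forall i, 1 <= b i,
        finite_set F &
        [set m : int | X (\val (aut_iter sigma m q))] =
          (\bigcup_i complete_progression (a i) (b i)) `|` F].
Proof.
have [s XE] := subX.
have [F FE] := aut_fun_morphism sigma; have [G GE] := aut_inv_morphism sigma.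
pose y (m : int) (i : 'I_N) : K := (\val (aut_iter sigma m q) : {ffun 'I_N -> K}) i.
have yS m i : y (m + 1) i = (F i).@[y m] by rewrite /y aut_iterS FE.
have yP m i : y (m - 1) i = (G i).@[y m] by rewrite /y aut_iterP GE.
(* The finite data of the problem: the base point and the coefficients of [sigma], its inverse and
   the equations of [X]. *)
pose L := codom (y 0) ++ flatten [seq mpoly_coefs h | h <- codom F ++ codom G ++ s].
have [M [B [j [jL sepB]]]] := padic_specializations L charK0.
have lift h : h \in codom F ++ codom G ++ s -> exists w, map_mpoly j w = h.
  move=> hs; apply: lift_mpoly => x xh; apply: jL; rewrite mem_cat; apply/orP; right.
  by apply/flattenP; exists (mpoly_coefs h) => //; apply: map_f.
have /choice[FB FBE] : forall i, exists w, map_mpoly j w = F i.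
  by move=> i; apply: lift; rewrite mem_cat codom_f.
have /choice[GB GBE] : forall i, exists w, map_mpoly j w = G i.
  by move=> i; apply: lift; rewrite !mem_cat codom_f orbT.
have /choice[z0 z0E] : forall i, exists b, j b = y 0 i.
  by move=> i; apply: jL; rewrite mem_cat codom_f.
have /choice[z zE] : forall m : int, exists z : 'I_N -> B, y m = fun i => j (z i).
  elim/int_ind => [|n [z zE]|n [z zE]].
  - by exists z0; apply/funext => i.
  - exists (fun i => (FB i).@[z]); apply/funext => i.
    by rewrite -addn1 PoszD yS zE -FBE meval_map_mpoly.
  - exists (fun i => (GB i).@[z]); apply/funext => i.
    by rewrite -addn1 PoszD opprD yP zE -GBE meval_map_mpoly.
(* The lifts [z m] are chosen independently of each other, so the relations between them hold only
   after applying [j]. *)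
have zS m i : j (z (m + 1) i) = j (FB i).@[z m].
  by rewrite -meval_map_mpoly FBE -[LHS]/((fun i => j (z (m + 1) i)) i) -zE yS zE.
have zP m i : j (z (m - 1) i) = j (GB i).@[z m].
  by rewrite -meval_map_mpoly GBE -[LHS]/((fun i => j (z (m - 1) i)) i) -zE yP zE.
pose Z := [set m : int | forall f, f \in s -> f.@[y m] = 0].
have -> : [set m : int | X (\val (aut_iter sigma m q))] = Z.
  apply/seteqP; split=> m /=.
    by rewrite XE => -[_ fs] f /fs.
  rewrite XE => fs; split; last by move=> f /fs.
  exact: set_valP.
pose b := uniform_period M N.
apply: (@progressions_of_residues Z b); first exact: uniform_period_gt0.
move=> r n0 /existsNP[f /not_implyP[fs /eqP f0]].
have [w wf] : exists w, map_mpoly j w = f by apply: lift; rewrite !mem_cat fs !orbT.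
have fE m : f.@[y m] = j w.@[z m] by rewrite zE -wf meval_map_mpoly.
pose m0 := r + b%:Z * n0.
(* Forward from [m0], where [f] does not vanish: applying [sigma] and its inverse to the middle
   point gives the next and the previous one, so [F - G] drives the recurrence. *)
have [||C1 C1P] := @separated_recurrence_eventually_neq0 K M N B j
    (fun i => FB i - GB i) w (fun n => z (m0 + n%:Z)) sepB.
- move=> n i; pose k := m0 + n.+1%:Z.
  rewrite (_ : m0 + n.+2%:Z = k + 1); last by rewrite /k; lia.
  rewrite (_ : m0 + n%:Z = k - 1); last by rewrite /k; lia.
  by rewrite rmorphD mevalB rmorphB -zP -zS [RHS]addrC subrK.
- by rewrite -fE addr0.
(* Backward from [m0] the roles of [F] and [G] are exchanged; the period is the same [b]. *)
have [||C2 C2P] := @separated_recurrence_eventually_neq0 K M N B j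
    (fun i => GB i - FB i) w (fun n => z (m0 - n%:Z)) sepB.
- move=> n i; pose k := m0 - n.+1%:Z.
  rewrite (_ : m0 - n.+2%:Z = k - 1); last by rewrite /k; lia.
  rewrite (_ : m0 - n%:Z = k + 1); last by rewrite /k; lia.
  by rewrite rmorphD mevalB rmorphB -zP -zS [RHS]addrC subrK.
- by rewrite -fE subr0.
exists (maxn C1 C2) => n nC /(_ f fs); apply/eqP.
have [n_ge0|n_lt0] := lerP 0 n.
- have := C1P `|n|%N; rewrite -fE PoszM gez0_abs // mulrDr addrA; apply.
  by apply: leq_trans nC; apply: leq_maxl.
- have := C2P `|n|%N; rewrite -fE PoszM ltz0_abs // mulrN opprK mulrDr addrA; apply.
  by apply: leq_trans nC; apply: leq_maxr.
Qed.
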